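(* For every integer $n\ge 0$, there is a bijection between the set of isomorphism classes of $XY$-graphs on $n$ vertices with no isolates in $Y$ and the set of isomorphism classes of minimal set covers of an $n$-element set which maps unbalanced $XY$-graphs to unbalanced minimal set covers and balanced $XY$-graphs to balanced minimal set covers.
   Context: An $XY$-graph is a bipartite graph with a specified ordered bipartition $X\cup Y$ of its vertices (edges join $X$ to $Y$); isomorphisms must map $X$ onto $X'$ and $Y$ onto $Y'$. A vertex of $Y$ is an isolate if it has no neighbor; a vertex of $X$ is universal if it is adjacent to every vertex of $Y$. An $XY$-graph with no isolates in $Y$ is unbalanced if $X$ has a universal vertex and balanced otherwise. A set cover of a finite set $V$ is a collection $\mathcal{C}$ of subsets of $V$ with union $V$; it is minimal if no member is contained in the union of the others. A minimal set cover is unbalanced if it contains a set of cardinality $|V|-|\mathcal{C}|+1$, and balanced otherwise. Set covers are identified under bijections of ground sets carrying members onto members. *)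

(* Defs.v *)
From HB Require Import structures.
From mathcomp Require Import all_boot.

Set Implicit Arguments.
Unset Strict Implicit.
Unset Printing Implicit Defensive.

Definition bijectiveb (T T' : finType) (f : {ffun T -> T'}) : bool :=
  injectiveb f && [forall y, y \in codom f].

Lemma bijectivebP (T T' : finType) (f : {ffun T -> T'}) :
  reflect (bijective f) (bijectiveb f).
Proof.
apply: (iffP andP) => [[/injectiveP f_inj /forallP f_surj] | f_bij].
  apply: inj_card_bij => //; rewrite -(card_codom f_inj).
  by apply/subset_leq_card/subsetP.
split; first by apply/injectiveP/bij_inj.
by case: f_bij => g _ fK; apply/forallP=> y; rewrite -(fK y) codom_f.
Qed.

(* The pair holds X and the edges, each edge being an unordered pair of        *)
(* vertices; Y is the complement of X.                                         *)
Record xygraph (V : finType) := XYGraph {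
  xy_data : {set V} * {set {set V}};
  _ : [forall e in xy_data.2, exists x in xy_data.1,
         exists y in ~: xy_data.1, e == [set x; y]]
}.

HB.instance Definition _ (V : finType) := [isSub for @xy_data V].
HB.instance Definition _ (V : finType) := [Finite of xygraph V by <:].

Section XYGraph.
Variable V : finType.
Implicit Types (G : xygraph V).

Definition partX G : {set V} := (xy_data G).1.
Definition partY G : {set V} := ~: partX G.
Definition edges G : {set {set V}} := (xy_data G).2.
Definition adjacent G (u v : V) : bool := [set u; v] \in edges G.

Definition isolate G (y : V) : bool := ~~ [exists u, adjacent G u y].
Definition universal G (x : V) : bool := [forall y in partY G, adjacent G x y].

Definition no_isolates_in_Y G : bool := [forall y in partY G, ~~ isolate G y].

Definition xy_unbalanced G : bool :=
  no_isolates_in_Y G && [exists x in partX G, universal G x].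
Definition xy_balanced G : bool :=
  no_isolates_in_Y G && ~~ [exists x in partX G, universal G x].

End XYGraph.

Definition xy_iso (V V' : finType) (G : xygraph V) (G' : xygraph V') : bool :=
  [exists f : {ffun V -> V'},
     [&& bijectiveb f, f @: partX G == partX G', f @: partY G == partY G'
       & [set f @: e | e : {set V} in edges G] == edges G']].

Section SetCover.
Variable V : finType.
Implicit Types (C : {set {set V}}).

Definition set_cover C : bool := cover C == [set: V].

Definition minimal_set_cover C : bool :=
  set_cover C && [forall A in C, ~~ (A \subset cover (C :\ A))].

(* The truncated subtraction is harmless: a minimal set cover of V has at most *)
(* #|V| members, since each has an element that lies in no other member.       *)
Definition cover_unbalanced C : bool :=
  minimal_set_cover C && [exists A in C, #|A| == #|V| - #|C| + 1].
Definition cover_balanced C : bool :=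
  minimal_set_cover C && ~~ [exists A in C, #|A| == #|V| - #|C| + 1].

End SetCover.

Definition cover_iso (V V' : finType)
    (C : {set {set V}}) (C' : {set {set V'}}) : bool :=
  [exists f : {ffun V -> V'},
     bijectiveb f && ([set f @: A | A : {set V} in C] == C')].

Lemma xy_iso_equiv (V : finType) : equivalence_rel (@xy_iso V V).
Proof.
have idE (A : {set V}) : [ffun x => x] @: A = A.
  by rewrite -[RHS]imset_id; apply: eq_imset => x; rewrite ffunE.
have idEE (E : {set {set V}}) :
    [set [ffun x => x] @: e | e : {set V} in E] = E.
  by rewrite -[RHS]imset_id; apply: eq_imset => e; rewrite idE.
apply/equivalence_relP; split=> [G | G H].
  apply/existsP; exists [ffun x => x]; rewrite !idE idEE !eqxx /= andbT.
  by apply/bijectivebP; exists id => x; rewrite ffunE.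
case/existsP=> f /and4P[/bijectivebP[g fK gK] /eqP fX /eqP fY /eqP fE] K.
apply/existsP/existsP=> -[h /and4P[/bijectivebP h_bij /eqP hX /eqP hY /eqP hE]].
  have gf (A : {set V}) : [ffun x => h (g x)] @: (f @: A) = h @: A.
    by rewrite -imset_comp; apply: eq_imset => x /=; rewrite ffunE fK.
  exists [ffun x => h (g x)]; rewrite -fX -fY -fE !gf hX hY !eqxx /=.
  rewrite -imset_comp; apply/andP; split.
    apply/bijectivebP/(@eq_bij _ _ (h \o g)) => [|x]; last by rewrite ffunE.
    by apply: bij_comp => //; exists f.
  by apply/eqP; rewrite -hE; apply: eq_imset => e /=; apply: gf.
have hf (A : {set V}) : [ffun x => h (f x)] @: A = h @: (f @: A).
  by rewrite -imset_comp; apply: eq_imset => x /=; rewrite ffunE.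
exists [ffun x => h (f x)]; rewrite !hf fX fY hX hY !eqxx /=.
apply/andP; split.
  apply/bijectivebP/(@eq_bij _ _ (h \o f)) => [|x]; last by rewrite ffunE.
  by apply: bij_comp => //; exists g.
by apply/eqP; rewrite -hE -fE -imset_comp; apply: eq_imset => e /=; apply: hf.
Qed.

Lemma cover_iso_equiv (V : finType) : equivalence_rel (@cover_iso V V).
Proof.
have idE (A : {set V}) : [ffun x => x] @: A = A.
  by rewrite -[RHS]imset_id; apply: eq_imset => x; rewrite ffunE.
have idEE (E : {set {set V}}) :
    [set [ffun x => x] @: e | e : {set V} in E] = E.
  by rewrite -[RHS]imset_id; apply: eq_imset => e; rewrite idE.
apply/equivalence_relP; split=> [C | C D].
  apply/existsP; exists [ffun x => x]; rewrite idEE eqxx andbT.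
  by apply/bijectivebP; exists id => x; rewrite ffunE.
case/existsP=> f /andP[/bijectivebP[g fK gK] /eqP fE] K.
apply/existsP/existsP=> -[h /andP[/bijectivebP h_bij /eqP hE]].
  exists [ffun x => h (g x)]; rewrite -fE -imset_comp; apply/andP; split.
    apply/bijectivebP/(@eq_bij _ _ (h \o g)) => [|x]; last by rewrite ffunE.
    by apply: bij_comp => //; exists f.
  apply/eqP; rewrite -hE; apply: eq_imset => e /=.
  by rewrite -imset_comp; apply: eq_imset => x /=; rewrite ffunE fK.
exists [ffun x => h (f x)]; apply/andP; split.
  apply/bijectivebP/(@eq_bij _ _ (h \o f)) => [|x]; last by rewrite ffunE.
  by apply: bij_comp => //; exists g.
apply/eqP; rewrite -hE -fE -imset_comp; apply: eq_imset => e /=.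
by rewrite -imset_comp; apply: eq_imset => x /=; rewrite ffunE.
Qed.

(* Every n-vertex graph, and every set cover of an n-element set, is isomorphic *)
(* to one on 'I_n, so the classes on 'I_n are all the isomorphism classes.      *)
Definition xy_classes (n : nat) : {set {set xygraph 'I_n}} :=
  equivalence_partition (@xy_iso 'I_n 'I_n)
    [set G : xygraph 'I_n | no_isolates_in_Y G].

Definition cover_classes (n : nat) : {set {set {set {set 'I_n}}}} :=
  equivalence_partition (@cover_iso 'I_n 'I_n)
    [set C : {set {set 'I_n}} | minimal_set_cover C].

Definition xy_class (n : nat) : Type :=
  {c : {set xygraph 'I_n} | c \in xy_classes n}.
Definition cover_class (n : nat) : Type :=
  {c : {set {set {set 'I_n}}} | c \in cover_classes n}.

(* Main.v *)
Require Import Defs.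
From mathcomp Require Import all_boot.

Set Implicit Arguments.
Unset Strict Implicit.
Unset Printing Implicit Defensive.

(** Send an XY-graph to the family of closed neighbourhoods [x |: N(x)] of its
vertices [x] in X. As [x] lies in no other member, this is a minimal cover with
[#|X|] members, and [x] is universal exactly when its member has
[#|Y| + 1 = #|V| - #|X| + 1] elements. Conversely, choosing in every member of a
minimal cover an element that lies in no other member gives the set X of a
preimage. Two such choices differ by an involution of the ground set which
preserves every member, so the preimage is unique up to isomorphism. *)

(** * Exchange of transversals, and bijections between sets of classes *)

(** Each of [A] and [B] meets every fibre of [k] over their common image in exactly one point. The
    map [s] swaps these two points in each such fibre and fixes everything else. *)
Lemma transversal_swap (T K : finType) (k : T -> K) (A B : {set T}) :
    {in A &, injective k} -> {in B &, injective k} -> k @: A = k @: B ->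
  exists s : T -> T, [/\ involutive s, s @: A = B & forall x, k (s x) = k x].
Proof.
move=> kA kB eqk.
(* The default [v] is never reached where [pckP] applies: equal images guarantee a point of [E] in
   the fibre of [v]. *)
pose pck (D : {set T}) v := odflt v [pick t in D | k t == k v].
have pckP (D E : {set T}) v : k @: D = k @: E -> v \in D ->
    pck E v \in E /\ k (pck E v) = k v.
  move=> eqDE vD; rewrite /pck; case: pickP => [t /andP[? /eqP ?] //|none].
  have: k v \in k @: E by rewrite -eqDE imset_f.
  by case/imsetP=> t tE kt; move: (none t); rewrite tE kt eqxx.
have AP v (vA : v \in A) := pckP _ _ _ eqk vA.
have BP v (vB : v \in B) := pckP _ _ _ (esym eqk) vB.
pose s v := if v \in A then pck B v else if v \in B then pck A v else v.
have sK : involutive s.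
  move=> v; rewrite {2}/s; case: ifP => [vA|vA].
    have [wB kw] := AP v vA; rewrite /s; case: ifP => [wA|_].
      rewrite (kA _ _ wA vA kw) in wB *.
      by have [zB kz] := AP v vA; apply: kB.
    by rewrite wB; have [zA kz] := BP _ wB; apply: kA; rewrite // kz.
  case: ifP => [vB|vB]; last by rewrite /s vA vB.
  have [wA kw] := BP v vB; rewrite /s wA.
  by have [zB kz] := AP _ wA; apply: kB; rewrite // kz.
exists s; split=> // [|v]; last first.
  rewrite /s; case: ifP => [/AP[]//|_]; by case: ifP => [/BP[]|].
apply/setP=> v; apply/imsetP/idP => [[u uA ->]|vB].
  by rewrite /s uA; case: (AP u uA).
exists (s v); last by rewrite sK.
rewrite /s; case: ifP => [vA|_]; last by rewrite vB; case: (BP v vB).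
by have [wB kw] := AP v vA; rewrite (kB _ _ wB vB kw).
Qed.

(** Classes are transported as sets: [up] saturates an image under [S], and [down] takes a preimage.
    The second clause of the conclusion speaks of arbitrary members of corresponding classes, so
    that isomorphism invariants can be compared across the bijection. *)
Lemma class_bijection (T U : finType) (R : rel T) (S : rel U)
    (D : {set T}) (E : {set U}) (F : T -> U) :
    equivalence_rel R -> equivalence_rel S ->
    {in D, forall x, F x \in E} ->
    {in D &, forall x y, S (F x) (F y) = R x y} ->
    {in E, forall u, exists2 x, x \in D & S (F x) u} ->
  exists f : {c : {set T} | c \in equivalence_partition R D} ->
             {d : {set U} | d \in equivalence_partition S E},
    bijective f /\
    forall (c : {c : {set T} | c \in equivalence_partition R D}) x u,
      x \in sval c -> u \in sval (f c) ->
      [/\ x \in D, u \in E & S (F x) u].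
Proof.
move=> /equivalence_relP[Rxx Rtr] /equivalence_relP[Sxx Str] FD FR Fsurj.
pose up (c : {set T}) := [set u in E | [exists x in c, S (F x) u]].
pose down (d : {set U}) := [set x in D | F x \in d].
have upE x : x \in D ->
    up [set y in D | R x y] = [set u in E | S (F x) u].
  move=> xD; apply/setP=> u; rewrite !inE; congr andb.
  apply/exists_inP/idP => [[y]|Su]; last by exists x; rewrite // inE xD Rxx.
  by rewrite inE => /andP[yD]; rewrite -FR // => /Str->.
have downE x : x \in D ->
    down [set u in E | S (F x) u] = [set y in D | R x y].
  move=> xD; apply/setP=> y; rewrite !inE; case yD: (y \in D) => //=.
  by rewrite FD // FR.
have repE (d : {d : {set U} | d \in equivalence_partition S E}) :
    exists2 x, x \in D & sval d = [set u in E | S (F x) u].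
  case: d => d /= /imsetP[u /Fsurj[x xD Sxu] ->]; exists x => //.
  by apply/setP=> w; rewrite !inE (Str _ _ Sxu).
have upP (c : {c : {set T} | c \in equivalence_partition R D}) :
    up (sval c) \in equivalence_partition S E.
  case: c => c /= /imsetP[x xD ->]; rewrite upE //.
  by apply/imsetP; exists (F x); rewrite ?FD.
have downP (d : {d : {set U} | d \in equivalence_partition S E}) :
    down (sval d) \in equivalence_partition R D.
  by have [x xD ->] := repE d; rewrite downE //; apply/imsetP; exists x.
exists (fun c => exist _ (up (sval c)) (upP c)); split.
  exists (fun d => exist _ (down (sval d)) (downP d)) => [c|d]; apply: val_inj.
    by case: c => c /= cP; case/imsetP: (cP) => x xD ->; rewrite upE ?downE.
  by rewrite /=; have [x xD ->] := repE d; rewrite downE ?upE.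
move=> [c cP] x u /=; case/imsetP: (cP) => y yD ->; rewrite upE // !inE.
case/andP=> xD Ryx /andP[uE Su]; split=> //.
by rewrite -FR // in Ryx; rewrite -(Str _ _ Ryx).
Qed.

(** * From graphs to minimal covers *)

Section Neighbourhoods.
Variable V : finType.
Implicit Types (G : xygraph V) (C : {set {set V}}).

(** Including [x] keeps vertices of X with the same neighbours apart, and makes the family cover
    X. *)
Definition closed_nbhd G (x : V) : {set V} := x |: [set y | adjacent G x y].

Definition nbhd_cover G : {set {set V}} := closed_nbhd G @: partX G.

Lemma adjacentC G u v : adjacent G u v = adjacent G v u.
Proof. by rewrite /adjacent setUC. Qed.

Lemma edgeP G e : e \in edges G ->
  exists x y, [/\ x \in partX G, y \notin partX G & e = [set x; y]].
Proof.
case: G => -[X E] /= GP eE; move/forall_inP: (GP) => /(_ e eE).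
case/exists_inP=> x xX /exists_inP[y]; rewrite inE => yX /eqP->.
by exists x, y.
Qed.

Lemma adjacent_parts G u v :
  adjacent G u v -> (u \in partX G) = (v \notin partX G).
Proof.
case/edgeP=> x [y [xX yX e]].
have xy : x == y = false by apply: contraNF yX => /eqP <-.
(* Edges are unordered, so each of [x], [y] may be [u] or [v]; the two coincident cases contradict
   [xy]. *)
have: (x \in [set u; v]) && (y \in [set u; v]) by rewrite e !inE !eqxx orbT.
rewrite !inE => /andP[/orP[]/eqP xe /orP[]/eqP ye]; subst;
  by rewrite ?eqxx // in xy; rewrite ?xX ?yX // (negPf yX).
Qed.

Lemma mem_closed_nbhd G x : x \in closed_nbhd G x.
Proof. exact: setU11. Qed.

Lemma mem_closed_nbhdX G x z : x \in partX G -> z \in partX G ->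
  (z \in closed_nbhd G x) = (z == x).
Proof.
move=> xX zX; rewrite !inE; case: eqP => //= _; apply/negP.
by move/adjacent_parts; rewrite xX zX.
Qed.

Lemma mem_closed_nbhdY G x y : x \in partX G -> y \notin partX G ->
  (y \in closed_nbhd G x) = adjacent G x y.
Proof. by move=> xX yX; rewrite !inE; case: eqP yX => // ->; rewrite xX. Qed.

Lemma closed_nbhd_inj G : {in partX G &, injective (closed_nbhd G)}.
Proof.
move=> x z xX zX e; apply/eqP.
by rewrite -(mem_closed_nbhdX zX xX) -e mem_closed_nbhd.
Qed.

Lemma card_nbhd_cover G : #|nbhd_cover G| = #|partX G|.
Proof. exact: card_in_imset (@closed_nbhd_inj G). Qed.

Lemma nbhd_cover_minimal G :
  no_isolates_in_Y G -> minimal_set_cover (nbhd_cover G).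
Proof.
move=> noiso; apply/andP; split.
  apply/eqP/setP=> v; rewrite inE; apply/bigcupP.
  have [vX|vX] := boolP (v \in partX G).
    by exists (closed_nbhd G v); rewrite ?imset_f ?mem_closed_nbhd.
  have := forall_inP noiso v; rewrite inE vX => /(_ isT); rewrite negbK.
  case/existsP=> u uv; exists (closed_nbhd G u); last by rewrite !inE uv orbT.
  by rewrite imset_f // (adjacent_parts uv).
apply/forall_inP=> _ /imsetP[x xX ->]; apply/negP => /subsetP/(_ x).
rewrite mem_closed_nbhd => /(_ isT) /bigcupP[A].
case/setD1P=> neq /imsetP[z zX eA]; rewrite eA mem_closed_nbhdX // => /eqP xz.
by case/eqP: neq; rewrite eA xz.
Qed.

(** The neighbours of [x] form a subset of Y, which is all of Y exactly when the cardinalities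
    agree; the summand 1 counts [x] itself. *)
Lemma universal_card G x : x \in partX G ->
  universal G x = (#|closed_nbhd G x| == #|V| - #|partX G| + 1).
Proof.
move=> xX; have -> : #|closed_nbhd G x| = #|[set y | adjacent G x y]| + 1.
  rewrite addn1 cardsU1 inE; case E: (adjacent G x x) => //.
  by move/adjacent_parts: E; rewrite xX.
have sub : [set y | adjacent G x y] \subset partY G.
  by apply/subsetP=> y; rewrite !inE => /adjacent_parts <-.
have -> : #|V| - #|partX G| = #|partY G| by rewrite -(cardsC (partX G)) addKn.
rewrite eqn_add2r (subset_leqif_card sub).
by apply/forall_inP/subsetP => H y yY; move: (H y yY); rewrite inE.
Qed.


Lemma nbhd_cover_unbalanced G : no_isolates_in_Y G ->
  cover_unbalanced (nbhd_cover G) = xy_unbalanced G.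
Proof.
move=> noiso; rewrite /cover_unbalanced /xy_unbalanced noiso /=.
rewrite (nbhd_cover_minimal noiso) card_nbhd_cover /=.
apply/exists_inP/exists_inP => [[_ /imsetP[x xX ->]]|[x xX]].
  by rewrite -universal_card //; exists x.
by rewrite universal_card // => cx; exists (closed_nbhd G x); rewrite ?imset_f.
Qed.

(** * From minimal covers back to graphs *)

(** This labels the cells of the Venn diagram of [C]: the value [[set A]] marks the points private
    to [A]. It serves as the map [k] of [transversal_swap]. *)
Definition members_at C (v : V) : {set {set V}} := [set A in C | v \in A].

(** The equality of images says at once that every point of [X] is private to some member and that
    every member has a private point in [X]. In this form, any two such sets for one cover satisfy
    the hypotheses of [transversal_swap]. *)
Definition private_transversal C (X : {set V}) : Prop :=
  {in X &, injective (members_at C)} /\ members_at C @: X = set1 @: C.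

Lemma members_at_partX G x : x \in partX G ->
  members_at (nbhd_cover G) x = [set closed_nbhd G x].
Proof.
move=> xX; apply/setP=> A; rewrite !inE.
apply/andP/eqP => [[/imsetP[z zX ->]]|->].
  by rewrite mem_closed_nbhdX // => /eqP->.
by rewrite imset_f // mem_closed_nbhd.
Qed.

Lemma partX_transversal G : private_transversal (nbhd_cover G) (partX G).
Proof.
split=> [x z xX zX|].
  by rewrite !members_at_partX // => /set1_inj; apply: closed_nbhd_inj.
rewrite /nbhd_cover -imset_comp; apply: eq_in_imset => x.
exact: members_at_partX.
Qed.

Lemma minimal_cover_transversal C : minimal_set_cover C ->
  exists X, private_transversal C X.
Proof.
case/andP=> _ /forall_inP minC.
(* The value [None] would mean that [A] lies in the union of the other members, which minimality
   forbids. *)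
pose p A := [pick v in A :\: cover (C :\ A)].
have pP A v : A \in C -> p A = Some v -> members_at C v = [set A].
  rewrite /p => AC; case: pickP => // w /setDP[wA wC] [<-].
  apply/setP=> B; rewrite !inE; apply/andP/eqP => [[BC wB]|-> //].
  apply/eqP; apply: contraNT wC => neq.
  by apply/bigcupP; exists B => //; apply/setD1P.
have p_ex A : A \in C -> exists v, p A = Some v.
  rewrite /p => AC; case: pickP => [v _|none]; first by exists v.
  case/negP: (minC A AC); apply/subsetP=> v vA.
  by move: (none v); rewrite inE vA andbT => /negbFE.
exists [set v | [exists A in C, p A == Some v]]; split=> [v w|].
  rewrite !inE => /exists_inP[A AC /eqP pv] /exists_inP[B BC /eqP pw].
  by rewrite (pP A v) // (pP B w) // => /set1_inj AB; move: pw; rewrite -AB pv => -[].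
apply/setP=> D; apply/imsetP/imsetP => [[v]|[A AC ->]].
  by rewrite inE => /exists_inP[A AC /eqP pv] ->; exists A; rewrite ?(pP A).
have [v pv] := p_ex A AC; exists v; last by rewrite (pP A).
by rewrite inE; apply/exists_inP; exists A; rewrite ?pv.
Qed.

(** Join [x] in [X] to [y] outside [X] when some member contains both. As [x] is private to one
    member, that member becomes its closed neighbourhood; covering then rules out isolates. *)
Lemma transversal_nbhd_cover C X : set_cover C -> private_transversal C X ->
  exists G, no_isolates_in_Y G /\ nbhd_cover G = C.
Proof.
move=> /eqP covC [injX imX].
pose E := [set e | [exists x in X, exists y in ~: X, exists A in C,
  [&& x \in A, y \in A & e == [set x; y]]]].
have GP : [forall e in (X, E).2, exists x in (X, E).1,
    exists y in ~: (X, E).1, e == [set x; y]].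
  apply/forall_inP=> e; rewrite inE => /exists_inP[x xX].
  case/exists_inP=> y yX /exists_inP[A _ /and3P[_ _ ee]].
  by apply/exists_inP; exists x => //; apply/exists_inP; exists y.
pose G : xygraph V := XYGraph GP.
have mem_at x A : members_at C x = [set A] -> A \in C /\ x \in A.
  by move/setP/(_ A); rewrite !inE eqxx => /andP.
have only x A B : members_at C x = [set A] -> B \in C -> x \in B -> B = A.
  by move/setP/(_ B); rewrite !inE => + BC xB; rewrite BC xB => /esym/eqP.
have atX x : x \in X -> exists2 A, A \in C & members_at C x = [set A].
  by move=> xX; apply/imsetP; rewrite -imX imset_f.
have adjE x y A : x \in X -> y \notin X -> members_at C x = [set A] ->
    adjacent G x y = (y \in A).
  move=> xX yX xA; have [AC xinA] := mem_at _ _ xA.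
  rewrite /adjacent inE; apply/idP/idP => [|yA]; last first.
    apply/exists_inP; exists x => //; apply/exists_inP; exists y.
      by rewrite inE.
    by apply/exists_inP; exists A; rewrite // xinA yA /=.
  case/exists_inP=> x' x'X /exists_inP[y' ]; rewrite inE => y'X.
  case/exists_inP=> B BC /and3P[x'B y'B /eqP e].
  (* The two pairs can match only with [x = x'] and [y = y'], since [X] separates their ends. *)
  have: (x \in [set x'; y']) && (y \in [set x'; y']) by rewrite -e !inE !eqxx orbT.
  rewrite !inE => /andP[/orP[]/eqP xe /orP[]/eqP ye]; subst;
    rewrite ?xX ?x'X // in y'X yX.
  by rewrite -(only _ _ _ xA BC x'B).
have nbhdE x A : x \in X -> members_at C x = [set A] -> closed_nbhd G x = A.
  move=> xX xA; apply/setP=> v; have [vX|vX] := boolP (v \in X); last first.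
    by rewrite mem_closed_nbhdY // (adjE _ _ A).
  rewrite mem_closed_nbhdX //; have [AC xinA] := mem_at _ _ xA.
  (* Another point [v] of [X] in [A] would also be private to [A], against the injectivity on
     [X]. *)
  apply/eqP/idP => [-> //|vA]; apply: injX => //; rewrite xA.
  by have [B BC vB] := atX v vX; rewrite vB (only _ _ _ vB AC vA).
have atC A : A \in C -> exists2 x, x \in X & members_at C x = [set A].
  move=> AC; have: [set A] \in members_at C @: X by rewrite imX imset_f.
  by case/imsetP=> x xX ->; exists x.
exists G; split.
  apply/forall_inP=> y; rewrite inE => yX; rewrite negbK.
  have: y \in cover C by rewrite covC inE.
  case/bigcupP=> A AC yA; have [x xX xA] := atC A AC.
  by apply/existsP; exists x; rewrite (adjE _ _ A).
apply/setP=> A; apply/imsetP/idP => [[x xX ->]|AC].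
  by have [B BC xB] := atX x xX; rewrite (nbhdE x B).
by have [x xX xA] := atC A AC; exists x; rewrite ?(nbhdE x A).
Qed.

End Neighbourhoods.

(** * Isomorphic graphs correspond to isomorphic covers *)

Section Isomorphisms.
Variables V V' : finType.
Implicit Types (C : {set {set V}}) (G : xygraph V).

Lemma members_at_imset (f : V -> V') C v : injective f ->
  members_at [set f @: A | A : {set V} in C] (f v) =
  [set f @: A | A : {set V} in members_at C v].
Proof.
move=> f_inj; apply/setP=> B; rewrite inE.
apply/andP/imsetP => [[/imsetP[A AC ->]]|[A]].
  by rewrite mem_imset // => vA; exists A; rewrite // inE AC.
by rewrite inE => /andP[AC vA] ->; rewrite !imset_f.
Qed.

Lemma private_transversal_imset (f : V -> V') C X : injective f ->
  private_transversal C X ->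
  private_transversal [set f @: A | A : {set V} in C] (f @: X).
Proof.
move=> f_inj [injX imX]; split=> [_ _ /imsetP[x xX ->] /imsetP[z zX ->]|].
  rewrite !members_at_imset // => /(imset_inj (imset_inj f_inj)) e.
  by rewrite (injX x z).
rewrite -!imset_comp.
pose F (D : {set {set V}}) := [set f @: A | A : {set V} in D].
transitivity (F @: (members_at C @: X)).
  by rewrite -imset_comp; apply: eq_imset => x /=; apply: members_at_imset.
by rewrite imX -imset_comp; apply: eq_imset => A; rewrite /= /F imset_set1.
Qed.

(** A bijection commutes with complements, so the condition on Y follows from the one on X; every
    edge is a pair, so adjacency determines the edge set. *)
Lemma xy_isoP G (G' : xygraph V') :
  reflect (exists f : V -> V', [/\ bijective f, f @: partX G = partX G'
             & forall u v, adjacent G' (f u) (f v) = adjacent G u v])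
          (xy_iso G G').
Proof.
apply: (iffP existsP) => [[f /and4P[/bijectivebP f_bij /eqP fX _ /eqP fE]]|].
  exists f; split=> // u v; rewrite /adjacent -fE.
  have -> : [set f u; f v] = f @: [set u; v] by rewrite imsetU1 imset_set1.
  exact/mem_imset/imset_inj/bij_inj.
case=> f [f_bij fX fA].
have ffE (A : {set V}) : finfun f @: A = f @: A.
  by apply: eq_imset => x; rewrite ffunE.
exists (finfun f); rewrite !ffE fX eqxx /=; apply/and3P; split.
- by apply/bijectivebP/(eq_bij f_bij) => x; rewrite ffunE.
- have [g fK gK] := f_bij; apply/eqP/setP=> y; rewrite !inE -fX -(gK y).
  by rewrite !mem_imset ?inE //; apply: can_inj fK.
apply/eqP/setP=> e; apply/imsetP/idP => [[d dE ->]|eE].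
  have [x [y [_ _ de]]] := edgeP dE; rewrite ffE de imsetU1 imset_set1.
  by rewrite -[_ \in _]/(adjacent G' _ _) fA /adjacent -de.
have [x [y [_ _ ee]]] := edgeP eE; have [g fK gK] := f_bij.
exists [set g x; g y]; last by rewrite ffE imsetU1 imset_set1 !gK.
by rewrite -[_ \in _]/(adjacent G _ _) -fA !gK /adjacent -ee.
Qed.

Lemma cover_isoP C (C' : {set {set V'}}) :
  reflect (exists2 f : V -> V', bijective f
             & [set f @: A | A : {set V} in C] = C')
          (cover_iso C C').
Proof.
apply: (iffP existsP) => [[f /andP[/bijectivebP f_bij /eqP fC]]|[f f_bij <-]].
  by exists f.
exists (finfun f); apply/andP; split.
  by apply/bijectivebP/(eq_bij f_bij) => x; rewrite ffunE.
by apply/eqP/eq_imset => A /=; apply: eq_imset => x; rewrite ffunE.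
Qed.

Lemma cover_iso_unbalanced C (C' : {set {set V'}}) : cover_iso C C' ->
  [exists A in C, #|A| == #|V| - #|C| + 1] =
  [exists A in C', #|A| == #|V'| - #|C'| + 1].
Proof.
case/cover_isoP=> f f_bij <-; have f_inj := bij_inj f_bij.
rewrite (card_imset _ (imset_inj f_inj)) -(bij_eq_card f_bij).
apply/exists_inP/exists_inP => [[A AC cA]|[_ /imsetP[A AC ->]]].
  by exists (f @: A); rewrite ?imset_f // card_imset.
by rewrite card_imset //; exists A.
Qed.

Lemma xy_iso_cover_iso G (G' : xygraph V') :
  xy_iso G G' -> cover_iso (nbhd_cover G) (nbhd_cover G').
Proof.
case/xy_isoP=> f [f_bij fX fA]; apply/cover_isoP; exists f => //.
rewrite /nbhd_cover -fX -!imset_comp; apply: eq_imset => x /=.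
have [g fK gK] := f_bij; apply/setP=> v; rewrite -(gK v).
by rewrite mem_imset ?(inj_eq (can_inj fK)) ?inE ?fA ?(can_eq fK) //; apply: can_inj fK.
Qed.

(** The cover isomorphism [f] need not map X to X': a vertex of Y with a single neighbour is also
    private to one member. Both [f @: partX G] and [partX G'] are private transversals of the same
    cover, so following [f] by the swap [s] repairs this without altering any member. *)
Lemma cover_iso_xy_iso G (G' : xygraph V') :
  cover_iso (nbhd_cover G) (nbhd_cover G') -> xy_iso G G'.
Proof.
case/cover_isoP=> f f_bij fC; have f_inj := bij_inj f_bij.
have [injS imS] := private_transversal_imset f_inj (partX_transversal G).
have [injT imT] := partX_transversal G'.
rewrite fC in injS imS.
have [s [sK sX sM]] := transversal_swap injS injT (etrans imS (esym imT)).
have memsf A v : A \in nbhd_cover G -> (s (f v) \in f @: A) = (v \in A).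
  move=> AG; have fAG : f @: A \in nbhd_cover G' by rewrite -fC imset_f.
  move/setP/(_ (f @: A)): (sM (f v)); rewrite !inE fAG /= => ->.
  exact: mem_imset.
have sf_bij : bijective (s \o f) by apply: bij_comp => //; exists s.
have sfX : (s \o f) @: partX G = partX G' by rewrite imset_comp.
have memX v : (s (f v) \in partX G') = (v \in partX G).
  by rewrite -sfX -[s (f v)]/((s \o f) v) mem_imset //; apply: bij_inj.
have nbhdE x : x \in partX G ->
    closed_nbhd G' (s (f x)) = f @: closed_nbhd G x.
  move=> xX; have AG : closed_nbhd G x \in nbhd_cover G by rewrite imset_f.
  (* The image of [closed_nbhd G x] is a member containing [s (f x)], and a vertex of X' lies in
     only one member. *)
  apply/esym/set1P; rewrite -members_at_partX ?memX // inE -fC imset_f //=.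
  by rewrite memsf // mem_closed_nbhd.
have adjX x v : x \in partX G ->
    adjacent G' (s (f x)) (s (f v)) = adjacent G x v.
  move=> xX; have [vX|vX] := boolP (v \in partX G).
    by apply/idP/idP => /adjacent_parts; rewrite ?memX xX vX.
  rewrite -!mem_closed_nbhdY ?memX // nbhdE // memsf //.
  exact: imset_f.
apply/xy_isoP; exists (s \o f); split=> // u v /=.
have [uX|uX] := boolP (u \in partX G); first exact: adjX.
have [vX|vX] := boolP (v \in partX G).
  by rewrite adjacentC adjX // adjacentC.
by apply/idP/idP => /adjacent_parts; rewrite ?memX (negPf uX) vX.
Qed.

End Isomorphisms.

(** * The bijection between classes *)

Theorem theorem5p2 (n : nat) :
  exists f : xy_class n -> cover_class n,
    [/\ bijective f,
        forall (c : xy_class n) (G : xygraph 'I_n) (C : {set {set 'I_n}}),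
          G \in sval c -> C \in sval (f c) ->
          xy_unbalanced G -> cover_unbalanced C
      & forall (c : xy_class n) (G : xygraph 'I_n) (C : {set {set 'I_n}}),
          G \in sval c -> C \in sval (f c) ->
          xy_balanced G -> cover_balanced C].
Proof.
have [|||f [f_bij fP]] := @class_bijection _ _ _ _
  [set G : xygraph 'I_n | no_isolates_in_Y G]
  [set C : {set {set 'I_n}} | minimal_set_cover C] (@nbhd_cover 'I_n)
  (@xy_iso_equiv 'I_n) (@cover_iso_equiv 'I_n).
- by move=> G; rewrite !inE; apply: nbhd_cover_minimal.
- move=> G H _ _; apply/idP/idP.
    exact: cover_iso_xy_iso.
  exact: xy_iso_cover_iso.
- move=> C; rewrite inE => Cmin; have [X XC] := minimal_cover_transversal Cmin.
  have [G [noiso <-]] := transversal_nbhd_cover (proj1 (andP Cmin)) XC.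
  exists G; rewrite ?inE //.
  by have [] := cover_iso_equiv (nbhd_cover G) (nbhd_cover G) (nbhd_cover G).
(* One equality serves both claims, since balanced is the negation of unbalanced once [G] has no
   isolates in Y and [C] is minimal. *)
have unb (c : xy_class n) G C : G \in sval c -> C \in sval (f c) ->
    [/\ no_isolates_in_Y G, minimal_set_cover C
      & cover_unbalanced C = xy_unbalanced G].
  move=> Gc Cc; have [] := fP _ _ _ Gc Cc; rewrite !inE => Gn Cm iso.
  rewrite -nbhd_cover_unbalanced // /cover_unbalanced Cm.
  by rewrite nbhd_cover_minimal // (cover_iso_unbalanced iso).
exists f; split=> // c G C Gc Cc; have [Gn Cm] := unb c G C Gc Cc.
  by move=> ->.
by rewrite /cover_unbalanced /xy_unbalanced /cover_balanced /xy_balanced Gn Cm /= => ->.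
Qed.
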